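(* Let $(a,b,c,\lambda,\delta)\in(\mathbb F^\times)^4\times\mathbb F$. The $\triangle_q$-module $W_\lambda^\delta(a,b,c)$ is reducible if and only if there exists an integer $i$ with $0\le i\le d'-1$ such that (i) there is $\mu\in\mathbb F^\times$ with $Ae_i=(\mu+\mu^{-1})e_i$ and $e_i$ an eigenvector of $(A-\mu q^2-\mu^{-1}q^{-2})B$ on $W_\lambda^\delta(a,b,c)$ (that is, $e_i$ is a marginal weight vector of the module $W_\lambda^\delta(a,b,c)$ twisted by the automorphism exchanging $A$ and $B$), and (ii) $L^{(i)}=0$, where $L^{(i)}$ is the coefficient of $w_0$ in $\prod_{h=1}^{d'-1}(B-\theta^*_{d'-h})e_i$ with respect to the basis $\{w_h\}_{h=0}^{d'-1}$.
   Context: $\mathbb F$ is an algebraically closed field and $q\in\mathbb F^\times$ a root of unity of order $d\notin\{1,2,4\}$; $d'=d$ if $d$ odd, $d'=d/2$ if $d$ even. $\triangle_q$ is the unital associative $\mathbb F$-algebra with generators $A,B,C$ subject to: each of $A+\frac{qBC-q^{-1}CB}{q^2-q^{-2}}$, $B+\frac{qCA-q^{-1}AC}{q^2-q^{-2}}$, $C+\frac{qAB-q^{-1}BA}{q^2-q^{-2}}$ is central; $\alpha,\beta,\gamma$ are these times $q+q^{-1}$. For $(a,b,c,\lambda)\in(\mathbb F^\times)^4$, $i\in\mathbb N$: $\theta_i=a\lambda^{-1}q^{2i}+a^{-1}\lambda q^{-2i}$, $\theta_i^*=b\lambda^{-1}q^{2i}+b^{-1}\lambda q^{-2i}$, $\varphi_i=a^{-1}b^{-1}\lambda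 q(q^i-q^{-i})(\lambda^{-1}q^{i-1}-\lambda q^{1-i})(q^{-i}-abc\lambda^{-1}q^{i-1})(q^{-i}-abc^{-1}\lambda^{-1}q^{i-1})$. $M_\lambda(a,b,c)$ has basis $\{m_i\}_{i\in\mathbb N}$, $(A-\theta_i)m_i=m_{i+1}$, $(B-\theta_i^* )m_i=\varphi_im_{i-1}$, $\alpha,\beta,\gamma$ acting as $(b+b^{-1})(c+c^{-1})+(a+a^{-1})(\lambda q+\lambda^{-1}q^{-1})$, $(c+c^{-1})(a+a^{-1})+(b+b^{-1})(\lambda q+\lambda^{-1}q^{-1})$, $(a+a^{-1})(b+b^{-1})+(c+c^{-1})(\lambda q+\lambda^{-1}q^{-1})$. $W_\lambda^\delta(a,b,c)$ is the quotient of $M_\lambda(a,b,c)$ by the span of $\{\delta m_i-m_{d'+i}\}_{i\in\mathbb N}$; $w_i$ is the image of $m_i$, and $\{w_i\}_{i=0}^{d'-1}$ is a basis. Fix $\nu\in\mathbb F^\times$ with $\nu^{d'}+\nu^{-d'}=\delta+a^{d'}\lambda^{-d'}+a^{-d'}\lambda^{d'}$, set $\vartheta_i=\nu^{-1}q^{2i}+\nu q^{-2i}$ and, for $0\le i\le d'-1$, $e_i=\sum_{h=1}^{d'}\prod_{j=h}^{d'-1}(\vartheta_i-\theta_j)\,w_{h-1}\in W_\lambda^\delta(a,b,c)$. *)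

(* Defs.v *)
From HB Require Import structures.
From mathcomp Require Import all_boot all_order all_algebra.
Set Implicit Arguments. Unset Strict Implicit. Unset Printing Implicit Defensive.
Import Order.TTheory GRing.Theory Num.Theory.
Local Open Scope ring_scope.

(* The module W_lambda^delta(a,b,c) of the algebra triangle_q, realized on the
   coordinate space F^(d') with respect to the basis w_0, ..., w_{d'-1}.
   Row-vector convention: a vector sum_k v_k w_k is the row vector v, and the
   generator X acts by v |-> v *m Xmat, where Xmat i j = coefficient of w_j
   in X w_i.  Integer exponents use exprz ( x ^ (z : int) ). *)

Section Wmodule.
Variables (F : closedFieldType) (q : F) (d : nat) (a b c lam delta : F).

Definition dp : nat := if odd d then d else d./2.

Definition theta (i : nat) : F :=
  a / lam * q ^ (2 * i%:Z) + lam / a * q ^ (- (2 * i%:Z)).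
Definition theta_s (i : nat) : F :=
  b / lam * q ^ (2 * i%:Z) + lam / b * q ^ (- (2 * i%:Z)).
Definition phi (i : nat) : F :=
  a^-1 * b^-1 * lam * q * (q ^ i%:Z - q ^ (- i%:Z))
  * (lam^-1 * q ^ (i%:Z - 1) - lam * q ^ (1 - i%:Z))
  * (q ^ (- i%:Z) - a * b * c / lam * q ^ (i%:Z - 1))
  * (q ^ (- i%:Z) - a * b / c / lam * q ^ (i%:Z - 1)).

(* gamma acts as this scalar *)
Definition gamma_sc : F :=
  (a + a^-1) * (b + b^-1) + (c + c^-1) * (lam * q + lam^-1 * q^-1).

(* A w_i = theta_i w_i + w_{i+1}, with w_{d'} = delta w_0 in W *)
Definition Amat : 'M[F]_dp :=
  \matrix_(i, j) ((i == j)%:R * theta i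
     + (if (i.+1 < dp)%N then (j == i.+1 :> nat)%:R
        else (j == 0%N :> nat)%:R * delta)).

Definition Bmat : 'M[F]_dp :=
  \matrix_(i, j) ((i == j)%:R * theta_s i + (j.+1 == i :> nat)%:R * phi i).

(* C is determined by the centrality relation:
   C + (qAB - q^{-1}BA)/(q^2-q^{-2}) acts as gamma/(q+q^{-1}).
   In row convention, the operator XY corresponds to Ymat *m Xmat. *)
Definition Cmat : 'M[F]_dp :=
  (gamma_sc / (q + q^-1))%:M
  - (q^2 - q^-2)^-1 *: (q *: (Bmat *m Amat) - q^-1 *: (Amat *m Bmat)).

Definition W_reducible : Prop :=
  exists U : 'M[F]_dp,
    [/\ \rank U != 0%N, \rank U != dp,
        (U *m Amat <= U)%MS, (U *m Bmat <= U)%MS & (U *m Cmat <= U)%MS].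

Variable nu : F.

Definition vtheta (i : nat) : F := nu^-1 * q ^ (2 * i%:Z) + nu * q ^ (- (2 * i%:Z)).

Definition evec (i : nat) : 'rV[F]_dp :=
  \row_k \prod_(k.+1 <= j < dp) (vtheta i - theta j).

Definition is_eigvec (M : 'M[F]_dp) (v : 'rV[F]_dp) : Prop :=
  v != 0 /\ exists kappa : F, v *m M = kappa *: v.

Definition coef_w0 (v : 'rV[F]_dp) : F := \sum_(k < dp | val k == 0%N) v 0 k.

(* prod_{h=1}^{d'-1} (B - theta*_{d'-h}) e_i  (the factors commute) *)
Definition Lvec (i : nat) : 'rV[F]_dp :=
  foldl (fun v h => v *m (Bmat - (theta_s (dp - h))%:M)) (evec i) (iota 1 dp.-1).

Definition Lcoef (i : nat) : F := coef_w0 (Lvec i).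

End Wmodule.

(* Main.v *)
Require Import Defs.
From HB Require Import structures.
From mathcomp Require Import all_boot all_order all_algebra.
From mathcomp Require Import ring.
Set Implicit Arguments. Unset Strict Implicit. Unset Printing Implicit Defensive.
Import Order.TTheory GRing.Theory Num.Theory.
Local Open Scope ring_scope.

(** With n = d', Q = q^2 and T x = x + 1/x, the matrices satisfy the
Askey-Wilson relations
A^2 B - (Q + 1/Q) A B A + B A^2 + (Q - 1/Q)^2 B = r0 + r1 A and the same with A
and B exchanged; the characteristic polynomial of A is the product of the
X - T(x Q^i), x = 1/nu, and every eigenspace of A is a line, spanned by a vector
e(z) depending only on T z.

If e is marginal, the second relation makes F[B] e stable under A; as the
product of the n - 1 factors B - theta*_h maps W into the line of w_0, the
condition L = 0 says exactly that F[B] e is not everything.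

Conversely let U be a proper nonzero submodule. It contains no w_0, whence L = 0
for each eigenvector in U. The first relation gives
(A - T(z Q)) (A - T(z/Q)) B e(z) in F e(z), so e(z) is marginal as soon as B e(z)
has no component along one of the two neighbours of T z. If U misses some e(z Q)
next to an e(z) that it contains, this is clear. Otherwise U contains every
eigenvector, so some T z is a double eigenvalue of A but a simple one on U, and
nu^2 is a power of Q. Walking along z, zQ, zQ^2, ... one meets a fixed
point z^2 = 1, a loop z^2 Q = 1, or a step from a simple to a double eigenvalue
of U, and each of them produces a marginal vector. *)

Lemma eq_of_subr (V : zmodType) (x y z : V) : x - y = z -> z = 0 -> x = y.
Proof. by move=> <- /subr0_eq. Qed.

Definition joukowski (F : fieldType) (x : F) : F := x + x^-1.

(** * Scalar identities behind the Askey-Wilson relations *)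

Section AskeyWilsonCoefficients.
Variables (F : fieldType) (q a b c lam : F).
Hypotheses (q0 : q != 0) (a0 : a != 0) (b0 : b != 0) (c0 : c != 0) (lam0 : lam != 0).

Let Q := q ^+ 2.
Let beta := Q + Q^-1.
Let rho := (Q - Q^-1) ^+ 2.
Let th X := joukowski (a / lam * X).
Let ths X := joukowski (b / lam * X).

(* phi_i as a function of X = q^(2i); it is n-periodic in i, unlike its factors. *)
Definition split_phi (X : F) : F :=
  a^-1 * b^-1 * lam * q * ((1 - X^-1) * (X / lam / q - lam * q))
  * (X^-1 * ((1 - a * b * c / lam * X / q) * (1 - a * b / c / lam * X / q))).

Let f := split_phi.
(** Multiples of the scalars of the central elements $\alpha,\beta,\gamma$; the factors in [q] arise
    on eliminating $C$ from their definitions. *)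
Definition aw_alpha := (q - q^-1) * (Q - Q^-1)
   * (joukowski b * joukowski c + joukowski a * joukowski (lam * q)).
Definition aw_beta := (q - q^-1) * (Q - Q^-1)
   * (joukowski c * joukowski a + joukowski b * joukowski (lam * q)).
Definition aw_gamma := - (q - q^-1) ^+ 2
   * (joukowski a * joukowski b + joukowski c * joukowski (lam * q)).

Ltac aw := rewrite /aw_alpha /aw_beta /aw_gamma /f /split_phi /th /ths
  /joukowski /rho /beta /Q; field; rewrite ?expf_neq0 ?q0 ?a0 ?b0 ?c0 ?lam0.

Lemma joukowski_shift u X : u != 0 -> X != 0 ->
  joukowski (u * X) + joukowski (u * (X * Q * Q)) = beta * joukowski (u * (X * Q)).
Proof. move=> u0 X0. aw. by rewrite u0 X0. Qed.
Lemma joukowski_quad u X : u != 0 -> X != 0 ->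
  joukowski (u * X) ^+ 2 - beta * joukowski (u * X) * joukowski (u * (X * Q))
  + joukowski (u * (X * Q)) ^+ 2 + rho = 0.
Proof. move=> u0 X0. aw. by rewrite u0 X0. Qed.

(** With [X = Q^i], this and the next three identities give the inner coefficients of the two
    relations applied to [w_i] (up to a factor [f X] for [pred]); the suffix says whether they
    belong to [w_{i+1}], [w_i] or [w_{i-1}]. The outer coefficients vanish by [joukowski_shift] and
    [joukowski_quad]. *)
Lemma aab_coef_succ X : X != 0 ->
  let t0 := th X in let t1 := th (X * Q) in let s0 := ths X in let s1 := ths (X * Q) in
  s0 * (t0 + t1) + f X - beta * (t0 * s0 + f (X * Q) + s1 * t1) + (t0 + t1) * s1 + f (X * Q * Q)
    = aw_gamma.
Proof. move=> X0 /=. aw. by rewrite X0. Qed.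

Lemma aab_coef_diag X : X != 0 ->
  let tm := th (X / Q) in
  let t0 := th X in let t1 := th (X * Q) in let s0 := ths X in let s1 := ths (X * Q) in
  s0 * t0 ^+ 2 + f X * (tm + t0) - beta * ((t0 * s0 + f (X * Q)) * t0 + t0 * f X)
    + t0 ^+ 2 * s0 + (t0 + t1) * f (X * Q) + rho * s0
    = aw_beta + aw_gamma * t0.
Proof. move=> X0 /=. aw. by rewrite X0. Qed.

Lemma bba_coef_diag X : X != 0 ->
  let sm := ths (X / Q) in
  let t0 := th X in let s0 := ths X in let s1 := ths (X * Q) in
  t0 * s0 ^+ 2 + f (X * Q) * (s1 + s0) - beta * ((s0 * t0 + f X) * s0 + s0 * f (X * Q))
    + s0 ^+ 2 * t0 + f X * (s0 + sm) + rho * t0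
    = aw_alpha + aw_gamma * s0.
Proof. move=> X0 /=. aw. by rewrite X0. Qed.

Lemma bba_coef_pred X : X != 0 ->
  let tm := th (X / Q) in let sm := ths (X / Q) in
  let t0 := th X in let s0 := ths X in
  t0 * (s0 + sm) + f (X * Q) - beta * (s0 * t0 + f X + tm * sm) + (s0 + sm) * tm + f (X / Q)
    = aw_gamma.
Proof. move=> X0 /=. aw. by rewrite X0. Qed.
End AskeyWilsonCoefficients.

(** * The Askey-Wilson relations for a split action of [A] and [B] *)

Section AskeyWilsonRelations.
Variables (F : fieldType) (q a b c lam : F).
Hypotheses (q0 : q != 0) (a0 : a != 0) (b0 : b != 0) (c0 : c != 0) (lam0 : lam != 0).

Let Q := q ^+ 2.
Let beta := Q + Q^-1.
Let rho := (Q - Q^-1) ^+ 2.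
Let th X := joukowski (a / lam * X).
Let ths X := joukowski (b / lam * X).
Let f := split_phi q a b c lam.

Variables (n : nat) (A B : 'M[F]_n) (w : nat -> 'rV[F]_n).
Hypothesis wA : forall i, w i *m A = th (Q ^+ i) *: w i + w i.+1.
Hypothesis wB : forall i, w i *m B = ths (Q ^+ i) *: w i + f (Q ^+ i) *: w i.-1.
Hypothesis w_inj : forall M : 'M[F]_n, (forall i, w i *m M = 0) -> M = 0.

Let Q0 : Q != 0. Proof. by rewrite expf_neq0. Qed.
Let Qi0 i : Q ^+ i != 0. Proof. by rewrite expf_neq0. Qed.

Let f1 : f 1 = 0.
Proof. by rewrite /f /split_phi invr1 subrr mul0r mulr0 mul0r. Qed.

(* Scaling by phi, which vanishes at 0, makes the junk values 0.-1 = 0.-2 = 0 harmless. *)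
Let u i := f (Q ^+ i) *: w i.-1.
Let v i := (f (Q ^+ i) * f (Q ^+ i / Q)) *: w i.-2.

Let uA i : u i *m A = th (Q ^+ i / Q) *: u i + f (Q ^+ i) *: w i.
Proof.
case: i => [|i]; first by rewrite /u expr0 f1 !scale0r mul0mx scaler0 addr0.
rewrite /u /= -scalemxAl wA exprSr mulfK // scalerDr !scalerA.
by rewrite [th _ * _]mulrC.
Qed.

Let uB i : u i *m B = ths (Q ^+ i / Q) *: u i + v i.
Proof.
case: i => [|i]; first by rewrite /u /v expr0 f1 mul0r !scale0r mul0mx scaler0 addr0.
rewrite /u /v /= -scalemxAl wB exprSr mulfK // scalerDr !scalerA.
by rewrite [ths _ * _]mulrC.
Qed.

Let vA i : v i *m A = th (Q ^+ i / Q / Q) *: v i + f (Q ^+ i / Q) *: u i.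
Proof.
case: i => [|[|i]].
- by rewrite /u /v expr0 f1 mul0r !scale0r mul0mx !scaler0 addr0.
- by rewrite /u /v expr1 divff // f1 mulr0 !scale0r mul0mx !scaler0 addr0.
rewrite /u /v /= -scalemxAl wA !exprSr !mulfK // scalerDr !scalerA.
by rewrite [th _ * _]mulrC [f _ * f (_ * Q)]mulrC.
Qed.

Let mx_eq_on_w (M N : 'M[F]_n) : (forall i, w i *m M = w i *m N) -> M = N.
Proof.
move=> eqMN; apply/eqP; rewrite -subr_eq0; apply/eqP/w_inj => i.
by rewrite mulmxBr eqMN subrr.
Qed.

Let wS j : w j.+1 *m B = ths (Q ^+ j.+1) *: w j.+1 + f (Q ^+ j.+1) *: w j.
Proof. exact: wB. Qed.

Let w_B i : w i *m B = ths (Q ^+ i) *: w i + u i.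
Proof. exact: wB. Qed.

(** [w] runs over all natural indices with one uniform formula, so no wrap-around case arises and it
    suffices to compare the coefficients of [w_{i+2}, ..., w_{i-1}]. *)
Lemma askey_wilson_AAB :
  B *m A *m A + A *m A *m B + rho *: B
    = beta *: (A *m B *m A) + (aw_beta q a b c lam)%:M + aw_gamma q a b c lam *: A.
Proof.
apply: mx_eq_on_w => i.
rewrite !mulmxDr -!scalemxAr !mulmxA mul_mx_scalar.
rewrite !(wA, wS, w_B, uA, mulmxDl, =^~ scalemxAl, scalerDr, scalerA).
have X0 := Qi0 i; rewrite !exprSr; move: (Q ^+ i) X0 => X X0.
have := aab_coef_succ q0 a0 b0 c0 lam0 X0.
have := aab_coef_diag q0 a0 b0 c0 lam0 X0.
have := joukowski_shift q0 (mulf_neq0 b0 (invr_neq0 lam0)) X0.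
have := joukowski_quad q0 (mulf_neq0 a0 (invr_neq0 lam0)) (mulf_neq0 X0 (invr_neq0 Q0)).
rewrite /= divfK // mulfK // -/Q -/beta -/rho -/f -!/(th _) -!/(ths _).
move: (aw_gamma _ _ _ _ _) (aw_beta _ _ _ _ _) => g e.
move=> Em E2 E0 E1; apply/rowP => k; rewrite !mxE.
pose x0 := w i 0 k; pose x1 := w i.+1 0 k; pose x2 := w i.+2 0 k.
apply: (@eq_of_subr _ _ _ (
   (ths X * (th X + th (X * Q)) + f X -
    beta * (th X * ths X + f (X * Q) + ths (X * Q) * th (X * Q)) +
    (th X + th (X * Q)) * ths (X * Q) + f (X * Q * Q) - g) * x1
  + (ths X * th X ^+ 2 + f X * (th (X / Q) + th X) -
    beta * ((th X * ths X + f (X * Q)) * th X + th X * f X) +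
    th X ^+ 2 * ths X + (th X + th (X * Q)) * f (X * Q) +
    rho * ths X - (e + g * th X)) * x0
  + (ths X + ths (X * Q * Q) - beta * ths (X * Q)) * x2
  + (th (X / Q) ^+ 2 - beta * th (X / Q) * th X + th X ^+ 2 + rho) * f X * w i.-1 0 k)).
  by rewrite /x0 /x1 /x2; ring.
by rewrite E1 E0 E2 Em !subrr !mul0r !addr0.
Qed.

Lemma askey_wilson_BBA :
  A *m B *m B + B *m B *m A + rho *: A
    = beta *: (B *m A *m B) + (aw_alpha q a b c lam)%:M + aw_gamma q a b c lam *: B.
Proof.
apply: mx_eq_on_w => i.
rewrite !mulmxDr -!scalemxAr !mulmxA mul_mx_scalar.
rewrite !(wA, wS, w_B, uA, uB, vA, mulmxDl, =^~ scalemxAl, scalerDr, scalerA).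
have X0 := Qi0 i; rewrite !exprSr; move: (Q ^+ i) X0 => X X0.
have := bba_coef_diag q0 a0 b0 c0 lam0 X0.
have := bba_coef_pred q0 a0 b0 c0 lam0 X0.
have := joukowski_shift q0 (mulf_neq0 a0 (invr_neq0 lam0))
  (mulf_neq0 (mulf_neq0 X0 (invr_neq0 Q0)) (invr_neq0 Q0)).
have := joukowski_quad q0 (mulf_neq0 b0 (invr_neq0 lam0)) X0.
rewrite /= !divfK // -/Q -/beta -/rho -/f -!/(th _) -!/(ths _).
move: (aw_gamma _ _ _ _ _) (aw_alpha _ _ _ _ _) => g e.
move=> E1 Emm Em E0; apply/rowP => k; rewrite !mxE.
pose x0 := w i 0 k; pose x1 := w i.+1 0 k.
apply: (@eq_of_subr _ _ _ (
   (ths X ^+ 2 - beta * ths X * ths (X * Q) + ths (X * Q) ^+ 2 + rho) * x1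
  + (th X * ths X ^+ 2 + f (X * Q) * (ths (X * Q) + ths X)
     - beta * ((ths X * th X + f X) * ths X + ths X * f (X * Q))
     + ths X ^+ 2 * th X + f X * (ths X + ths (X / Q)) + rho * th X - (e + g * ths X)) * x0
  + (th X * (ths X + ths (X / Q)) + f (X * Q)
     - beta * (ths X * th X + f X + th (X / Q) * ths (X / Q))
     + (ths X + ths (X / Q)) * th (X / Q) + f (X / Q) - g) * f X * w i.-1 0 k
  + (th (X / Q / Q) + th X - beta * th (X / Q)) * (f X * f (X / Q)) * w i.-2 0 k)).
  by rewrite /x0 /x1; ring.
by rewrite E1 E0 Em Emm !subrr !mul0r !addr0.
Qed.
End AskeyWilsonRelations.

(** * The map [joukowski] along an orbit of [Q] *)

Lemma prod_joukowski (F : fieldType) (n : nat) (Q x y : F) :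
    n.-primitive_root Q -> x != 0 -> y != 0 ->
  \prod_(j < n) (joukowski x - joukowski (y * Q ^+ j))
    = joukowski (x ^+ n) - joukowski (y ^+ n).
Proof.
move=> Qn x0 y0.
have Q0 j : Q ^+ j != 0 by rewrite expf_neq0 // (prim_root_eq0 Qn) -lt0n (prim_order_gt0 Qn).
have prodB z : \prod_(j < n) (z - Q ^+ j) = z ^+ n - 1.
  have := congr1 (horner^~ z) (factor_Xn_sub_1 Qn).
  rewrite horner_prod !hornerE big_mkord => <-.
  by apply: eq_bigr => j _; rewrite hornerXsubC.
(* The denominator is kept as [0 - Q ^+ j] so that [prodB] at [z = 0] evaluates it as well and
   absorbs the sign. *)
transitivity (\prod_(j < n) ((x / y - Q ^+ j) * y *
    (((x * y)^-1 - Q ^+ j) / (0 - Q ^+ j)))).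
  apply: eq_bigr => j _; rewrite /joukowski.
  by move: (Q ^+ j) (Q0 j) => z z0; field; rewrite oppr_eq0 x0 y0 z0.
rewrite !big_split /= prodfV !prodB prodr_const card_ord expr0n.
rewrite (gtn_eqF (prim_order_gt0 Qn)) /joukowski !(exprMn, exprVn).
rewrite mulr0n; field; by rewrite ?oppr_eq0 ?oner_eq0 ?andbT !expf_neq0.
Qed.

(** The difference [s] vanishes everywhere, so [s + 1] has no root; over an algebraically closed
    field it is then constant, and so is [s]. *)
Lemma eq_poly_horner (F : closedFieldType) (p r : {poly F}) :
  (forall x, p.[x] = r.[x]) -> p = r.
Proof.
move=> pr; apply/eqP; rewrite -subr_eq0; set s := p - r.
have s0 x : s.[x] = 0 by rewrite !hornerE pr subrr.
have /size_poly1P [k _ sE] : size (s + 1) == 1%N.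
  rewrite -[_ == _]negbK; apply/negP => /closed_rootP [x].
  by rewrite rootE hornerD s0 -polyC1 hornerC add0r oner_eq0.
have : s = (k - 1)%:P by rewrite polyCB -sE addrK.
by move=> sC; have := s0 0; rewrite sC hornerC => ->.
Qed.

Lemma joukowskiV (F : fieldType) (x : F) : joukowski x^-1 = joukowski x.
Proof. by rewrite /joukowski invrK addrC. Qed.

Lemma eq_joukowski (F : fieldType) (x y : F) : x != 0 -> y != 0 ->
  (joukowski x == joukowski y) = (x == y) || (x * y == 1).
Proof.
move=> x0 y0; rewrite -[_ == joukowski y]subr_eq0 -[x == y]subr_eq0 -[_ == 1]subr_eq0.
have -> : joukowski x - joukowski y = (x - y) * (x * y - 1) / (x * y).
  by rewrite /joukowski; field; rewrite ?x0 ?y0.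
by rewrite !mulf_eq0 invr_eq0 mulf_eq0 (negPf x0) (negPf y0) !orbF.
Qed.

Lemma joukowski_surj (F : closedFieldType) (t : F) : exists2 x, x != 0 & joukowski x = t.
Proof.
have [x] := @solve_monicpoly F 2 (fun i => if i == 0%N then -1 else t) isT.
rewrite !big_ord_recl big_ord0 /= expr0 mulr1 addr0 expr1 => xE.
have x0 : x != 0.
  by apply/eqP => x0; move/eqP: xE; rewrite x0 expr0n mulr0 addr0 eq_sym oppr_eq0 oner_eq0.
exists x => //; apply: (mulIf x0); rewrite /joukowski mulrDl mulVf // -expr2 xE.
by rewrite addrAC addNr add0r.
Qed.

(** The equation [v A = t v], solved downwards from a last coordinate equal to 1: coordinate [k - 1]
    is [t - theta_k] times coordinate [k]. *)
Definition eigenrow (F : fieldType) (n : nat) (Q y t : F) : 'rV[F]_n :=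
  \row_k \prod_(k.+1 <= j < n) (t - joukowski (y * Q ^+ j)).

(** * Spectrum and eigenlines of [A] *)

Section RaisingOperator.
Variables (F : closedFieldType) (n' : nat).
Let n := n'.+1.
Variables (Q y x delta : F) (A : 'M[F]_n) (w : nat -> 'rV[F]_n).
Hypotheses (Qn : n.-primitive_root Q) (y0 : y != 0) (x0 : x != 0).
Local Notation th i := (joukowski (y * Q ^+ i)).
Local Notation vth i := (joukowski (x * Q ^+ i)).
Hypothesis wA : forall i, w i *m A = th i *: w i + w i.+1.
Hypothesis w_delta : forall k : 'I_n, w k = delta_mx 0 k.
Hypothesis w_n : w n = delta *: w 0%N.
Hypothesis x_delta : joukowski (x ^+ n) = delta + joukowski (y ^+ n).

Local Notation eigenrow t := (eigenrow n Q y t).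

Definition charpol : {poly F} := \prod_(i < n) ('X - (vth i)%:P).

(** At [t = T z] both sides equal [T (z^n) - T (x^n)] by [prod_joukowski] and the choice of [x], and
    every [t] has this form. *)
Lemma charpolE : charpol = \prod_(i < n) ('X - (th i)%:P) - delta%:P.
Proof.
apply: eq_poly_horner => t; have [z z0 <-] := joukowski_surj t.
rewrite !hornerE !horner_prod.
under eq_bigr do rewrite hornerXsubC; under [in RHS]eq_bigr do rewrite hornerXsubC.
by rewrite !prod_joukowski // x_delta opprD addrA addrAC.
Qed.

Lemma eigenrow_mulA t : charpol.[t] = 0 -> eigenrow t *m A = t *: eigenrow t.
Proof.
rewrite charpolE !hornerE horner_prod => /eqP; rewrite subr_eq0.
under eq_bigr do rewrite hornerXsubC; move=> /eqP tE.
pose p k := \prod_(k <= j < n) (t - th j).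
have -> : eigenrow t = \sum_(0 <= k < n) p k.+1 *: w k.
  rewrite big_mkord [LHS]row_sum_delta; apply: eq_bigr => k _.
  by rewrite w_delta mxE.
apply/eqP; rewrite eq_sym -subr_eq0 mulmx_suml scaler_sumr -sumrB.
(* The sum telescopes to [p 0 *: w 0 - w n], which vanishes because [p 0 = delta] at a root of
   [charpol]. *)
rewrite (eq_big_nat _ _ (F2 := fun k => - (p k.+1 *: w k.+1 - p k *: w k))); last first.
  move=> k /andP [_ kn]; rewrite -scalemxAl wA scalerDr opprD addrA opprB.
  have -> : p k = (t - th k) * p k.+1 by rewrite /p big_ltn.
  by rewrite !scalerA -scalerBl mulrBl [th k * _]mulrC.
rewrite sumrN telescope_sumr // /p big_geq // scale1r big_mkord tE w_n.
by rewrite subrr oppr0.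
Qed.

Lemma mulA_coord (v : 'rV[F]_n) (j k : 'I_n) : k = j.+1 :> nat ->
  (v *m A) 0 k = v 0 k * th k + v 0 j.
Proof.
move=> kj.
have AE (i : 'I_n) : A i k = (i == k)%:R * th k + (i == j)%:R.
  transitivity ((w i *m A) 0 k); first by rewrite w_delta -rowE mxE.
  rewrite wA w_delta !mxE eqxx [k == i]eq_sym mulrC /=; congr (_ + _).
    by case: eqP => [->|] //; rewrite !mul0r.
  have [iN|iN] := ltnP i.+1 n.
    have := w_delta (Ordinal iN); move=> /= ->; rewrite !mxE /=.
    by rewrite -val_eqE /= kj eqSS eq_sym.
  have iE : i.+1 = n by apply/eqP; rewrite eqn_leq iN ltn_ord.
  rewrite iE w_n (w_delta ord0) !mxE /= -[k == _]val_eqE /= kj mulr0.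
  case: eqP => // ij; move: (ltn_ord k); rewrite kj -ij iE /n ltnn //.
rewrite mxE; under eq_bigr do rewrite AE mulrDr.
rewrite big_split /= (bigD1 k) //= eqxx mul1r big1 => [|i /negPf ->]; last by rewrite mul0r mulr0.
by rewrite addr0 (bigD1 j) //= eqxx mulr1 big1 ?addr0 // => i /negPf ->; rewrite mulr0.
Qed.

(** By [mulA_coord] each coordinate of an eigenvector determines the preceding one, so a solution of
    [v A = t v] with last coordinate 0 vanishes. *)
Lemma eigenrow_uniq t (v : 'rV[F]_n) : charpol.[t] = 0 ->
  v *m A = t *: v -> exists s, v = s *: eigenrow t.
Proof.
move=> tr vA; exists (v 0 ord_max); apply/eqP; rewrite -subr_eq0; apply/eqP.
set d := v - _.
have dA : d *m A = t *: d by rewrite /d mulmxBl -scalemxAl eigenrow_mulA // vA scalerBr !scalerA [t * _]mulrC.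
have dmax : d 0 ord_max = 0 by rewrite !mxE big_geq // mulr1 subrr.
have d0 m : forall k : 'I_n, (k + m = n')%N -> d 0 k = 0.
  elim: m => [|m IH] k km.
    by rewrite -dmax; congr (d 0 _); apply: val_inj; rewrite /= -km addn0.
  have kn : (k.+1 < n)%N by rewrite ltnS -km -addSnnS leq_addr.
  have := mulA_coord d (erefl : Ordinal kn = k.+1 :> nat).
  by rewrite dA mxE (IH (Ordinal kn)) ?addSnnS // mulr0 mul0r add0r.
apply/rowP => k; rewrite [RHS]mxE (d0 (n' - k)%N) // subnKC // -ltnS; exact: ltn_ord.
Qed.

Lemma eigenrow_neq0 t : eigenrow t != 0.
Proof.
apply/eqP => /rowP /(_ ord_max); rewrite !mxE big_geq // => /eqP.
by rewrite oner_eq0.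
Qed.

Lemma w_pol k : w 0%N *m horner_mx A (\prod_(i < k) ('X - (th i)%:P)) = w k.
Proof.
elim: k => [|k IH]; first by rewrite big_ord0 rmorph1 mulmx1.
rewrite big_ord_recr /= rmorphM /= mulmxA IH rmorphB /= horner_mx_X horner_mx_C.
by rewrite mulmxBr mul_mx_scalar wA addrAC subrr add0r.
Qed.

(** [w 0] is cyclic for [A], and [charpolE] with [w n = delta *: w 0] shows that [charpol] kills it;
    polynomials in [A] commute. *)
Lemma charpol_mx : horner_mx A charpol = 0.
Proof.
apply/row_matrixP => i; rewrite row0 rowE -w_delta -w_pol -mulmxA.
rewrite (comm_horner_mx2 A _ charpol : _ *m _ = _ *m _) mulmxA.
by rewrite charpolE rmorphB /= horner_mx_C mulmxBr mul_mx_scalar w_pol w_n subrr mul0mx.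
Qed.
End RaisingOperator.

Lemma horner_mx_stable (F : fieldType) (n' m : nat) (A : 'M[F]_n'.+1)
    (U : 'M[F]_(m, n'.+1)) (p : {poly F}) :
  (U *m A <= U)%MS -> (U *m horner_mx A p <= U)%MS.
Proof.
move=> UA; elim/poly_ind: p => [|p k IH]; first by rewrite rmorph0 mulmx0 sub0mx.
rewrite rmorphD rmorphM /= horner_mx_X horner_mx_C mulmxDr mulmxA mul_mx_scalar.
by rewrite addmx_sub ?scalemx_sub // (submx_trans (submxMr A IH)).
Qed.

Lemma eigenrow_horner (F : fieldType) (n' : nat) (A : 'M[F]_n'.+1) (v : 'rV[F]_n'.+1)
    (t : F) (p : {poly F}) :
  v *m A = t *: v -> v *m horner_mx A p = p.[t] *: v.
Proof.
move=> vA; elim/poly_ind: p => [|p k IH]; first by rewrite rmorph0 mulmx0 horner0 scale0r.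
rewrite rmorphD rmorphM /= horner_mx_X horner_mx_C mulmxDr mulmxA mul_mx_scalar.
by rewrite IH -scalemxAl vA scalerA -scalerDl !hornerE.
Qed.

(** * How [B] moves eigenvectors and Jordan chains of [A] *)

Section TridiagonalAction.
Variables (F : fieldType) (n : nat) (A B U : 'M[F]_n) (beta rho r0 r1 : F).
Hypothesis AAB : B *m A *m A + A *m A *m B + rho *: B
  = beta *: (A *m B *m A) + r0%:M + r1 *: A.
Hypotheses (UA : (U *m A <= U)%MS) (UB : (U *m B <= U)%MS).

Let UAr (v : 'rV_n) : (v <= U)%MS -> (v *m A <= U)%MS.
Proof. by move=> vU; apply: submx_trans (submxMr A vU) UA. Qed.
Let UBr (v : 'rV_n) : (v <= U)%MS -> (v *m B <= U)%MS.
Proof. by move=> vU; apply: submx_trans (submxMr B vU) UB. Qed.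

Let UBA (v : 'rV_n) z : (v <= U)%MS -> (v *m B *m (A - z%:M) <= U)%MS.
Proof.
move=> vU; rewrite mulmxBr mul_mx_scalar addmx_sub ?UAr ?UBr //.
by rewrite eqmx_opp scalemx_sub ?UBr.
Qed.

(* [f] is an eigenvector when [eps = 0] and lies over [e] in a Jordan block when [eps = 1]. *)
Lemma jordan_quadratic (e f : 'rV[F]_n) (x y z eps : F) :
    f *m A = x *: f + eps *: e -> e *m A = x *: e ->
    y + z = beta * x -> y * z = x ^+ 2 + rho ->
  f *m B *m (A - z%:M) *m (A - y%:M)
    = eps *: (beta *: (e *m B *m A) - (2 * x) *: (e *m B)) + (r0 + r1 * x) *: f + (r1 * eps) *: e.
Proof.
move=> fA eA yz yzM.
have := congr1 (mulmx f) AAB.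
rewrite !mulmxDr -!scalemxAr !mulmxA mul_mx_scalar fA.
rewrite !(mulmxDl, mulmxN, mulNmx, =^~ scalemxAl, fA, eA, scalerDr, scalerA, mulmxDr, mul_mx_scalar).
move=> /rowP H; apply/rowP => k; move: {H}(H k); rewrite !mxE.
have -> : rho = y * z - x ^+ 2 by rewrite yzM addrAC subrr add0r.
rewrite -yz.
by move=> /eqP; rewrite -subr_eq0 => /eqP; apply: eq_of_subr; ring.
Qed.

(** For [x = T u], [beta = Q + 1/Q] and [rho = (Q - 1/Q)^2], the conditions on [y] and [z] say that
    they are the neighbours [T (u Q)] and [T (u / Q)], in some order. *)
Lemma eigen_quadratic (e : 'rV[F]_n) (x y z : F) :
    e *m A = x *: e -> y + z = beta * x -> y * z = x ^+ 2 + rho ->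
  e *m B *m (A - z%:M) *m (A - y%:M) = (r0 + r1 * x) *: e.
Proof.
move=> eA yz yzM.
have eA' : e *m A = x *: e + 0 *: e by rewrite scale0r addr0.
by rewrite (jordan_quadratic eA' eA yz yzM) scale0r mulr0 scale0r add0r addr0.
Qed.

Variables (e : 'rV[F]_n) (x y z : F).
Hypotheses (eU : (e <= U)%MS) (eA : e *m A = x *: e).
Hypotheses (yz : y + z = beta * x) (yzM : y * z = x ^+ 2 + rho).

Local Notation v := (e *m B *m (A - z%:M)).
Let vU : (v <= U)%MS. Proof. exact: UBA. Qed.
Let vA : v *m A = y *: v + (r0 + r1 * x) *: e.
Proof.
by rewrite -(eigen_quadratic eA yz yzM) [v *m (A - _)]mulmxBr mul_mx_scalar [RHS]addrC subrK.
Qed.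

(** [v A] is [y v] plus a multiple of [e]; when [x != y], removing [k e] turns [v] into a solution
    of [u A = y u]. *)
Let k := (r0 + r1 * x) / (x - y).
Let shifted_eigen : x != y -> (v - k *: e) *m A = y *: (v - k *: e).
Proof.
move=> xy; rewrite mulmxBl vA -scalemxAl eA scalerBr -addrA; congr (_ + _).
rewrite !scalerA -scalerBl -scaleNr; congr (_ *: _); rewrite /k.
by field; rewrite subr_eq0.
Qed.

Lemma marginal_of_missing : x != y ->
    (forall u : 'rV_n, (u <= U)%MS -> u *m A = y *: u -> u = 0) ->
  exists kappa, v = kappa *: e.
Proof.
move=> xy noy; exists k; apply/eqP; rewrite -subr_eq0; apply/eqP/noy.
  by rewrite addmx_sub // eqmx_opp scalemx_sub.
exact: shifted_eigen.
Qed.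

(** [p] is a functional which on [U] is an eigenvector of the transpose of [A], for [y]. It kills
    [e] since [x != y], and takes the value [(y - z) p(e B) = 0] on [v]. As [v - k e] is a multiple
    of [e'], which [p] does not kill, it vanishes. *)
Lemma marginal_of_functional (e' : 'rV[F]_n) (p : 'cV[F]_n) : x != y ->
    (forall u : 'rV_n, u *m A = y *: u -> exists s, u = s *: e') ->
    (forall u : 'rV_n, (u <= U)%MS -> u *m A *m p = y *: (u *m p)) ->
    e' *m p != 0 -> (y - z) *: (e *m B *m p) = 0 ->
  exists kappa, v = kappa *: e.
Proof.
move=> xy eig pU e'p ep; exists k.
have [s sE] := eig _ (shifted_eigen xy).
have ep0 : e *m p = 0.
  have /eqP := pU _ eU; rewrite eA -scalemxAl -subr_eq0 -scalerBl scaler_eq0 subr_eq0.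
  by rewrite (negPf xy) => /eqP.
have : (v - k *: e) *m p = 0.
  rewrite mulmxBl -scalemxAl ep0 scaler0 subr0 mulmxBr mul_mx_scalar mulmxBl pU ?UBr //.
  by rewrite -scalemxAl -scalerBl.
rewrite sE -scalemxAl => /eqP; rewrite scaler_eq0 (negPf e'p) orbF => /eqP s0.
by apply/eqP; rewrite -subr_eq0 sE s0 scale0r.
Qed.

(** Here [v A = x v + c e]; applying [p] gives [c p(e) = 0], so [c = 0] and [v] lies on the
    eigenline of [e]. *)
Lemma marginal_of_loop (p : 'cV[F]_n) : x = y ->
    (forall u : 'rV_n, u *m A = x *: u -> exists s, u = s *: e) ->
    (forall u : 'rV_n, (u <= U)%MS -> u *m A *m p = x *: (u *m p)) ->
    e *m p != 0 ->
  exists kappa, v = kappa *: e.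
Proof.
move=> xy eig pU ep; apply: eig; rewrite vA -xy.
have := pU _ vU; rewrite vA -xy mulmxDl -!scalemxAl.
move/eqP; rewrite -subr_eq0 addrAC subrr add0r scaler_eq0 (negPf ep) orbF => /eqP ->.
by rewrite scale0r addr0.
Qed.

(** [p] kills [e] and [f], so applying it to [jordan_quadratic] with [eps = 1] leaves
    [(beta y - 2 x) p(e B) = 0]. *)
Lemma jordan_functional (f : 'rV[F]_n) (p : 'cV[F]_n) : x != y -> (f <= U)%MS ->
    f *m A = x *: f + e ->
    (forall u : 'rV_n, (u <= U)%MS -> u *m A *m p = y *: (u *m p)) ->
    beta * y != 2 * x ->
  e *m B *m p = 0.
Proof.
move=> xy fU fA pU nez.
have ep0 : e *m p = 0.
  have /eqP := pU _ eU; rewrite eA -scalemxAl -subr_eq0 -scalerBl scaler_eq0 subr_eq0.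
  by rewrite (negPf xy) => /eqP.
have fp0 : f *m p = 0.
  have /eqP := pU _ fU; rewrite fA mulmxDl -scalemxAl ep0 addr0.
  rewrite -subr_eq0 -scalerBl scaler_eq0 subr_eq0.
  by rewrite (negPf xy) => /eqP.
have fA' : f *m A = x *: f + 1 *: e by rewrite scale1r.
have := congr1 (mulmx^~ p) (jordan_quadratic fA' eA yz yzM).
rewrite mulmxBr mul_mx_scalar mulmxBl pU ?UBA // -scalemxAl subrr.
rewrite !mulmxDl -!scalemxAl ep0 fp0 !scaler0 !addr0 scale1r mulmxBl -!scalemxAl.
rewrite pU ?UBr // scalerA -scalerBl => /esym /eqP.
by rewrite scaler_eq0 subr_eq0 (negPf nez) => /eqP.
Qed.
End TridiagonalAction.

Lemma exists_last_step (P : nat -> bool) (j : nat) : P 0%N -> ~~ P j ->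
  exists i, P i && ~~ P i.+1.
Proof.
elim: j => [->//|j IH] P0 Pj; have [Pj'|/IH] := boolP (P j); last exact.
by exists j; rewrite Pj'.
Qed.

(** * A marginal vector in every proper nonzero submodule *)

Section ProperSubmodule.
Variables (F : closedFieldType) (n' : nat).
Let n := n'.+1.
Variables (Q y x delta : F) (A B : 'M[F]_n) (w : nat -> 'rV[F]_n).
Hypotheses (Qn : n.-primitive_root Q) (y0 : y != 0) (x0 : x != 0) (n2 : (2 < n)%N).
Hypothesis wA : forall i, w i *m A = joukowski (y * Q ^+ i) *: w i + w i.+1.
Hypothesis w_delta : forall k : 'I_n, w k = delta_mx 0 k.
Hypothesis w_n : w n = delta *: w 0%N.
Hypothesis x_delta : joukowski (x ^+ n) = delta + joukowski (y ^+ n).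
Variables (r0 r1 : F).
Hypothesis AAB : B *m A *m A + A *m A *m B + (Q - Q^-1) ^+ 2 *: B
  = (Q + Q^-1) *: (A *m B *m A) + r0%:M + r1 *: A.

Local Notation T := joukowski.
Local Notation chi := (charpol n' Q x).
Local Notation e z := (eigenrow n Q y (T z)).

Definition in_spectrum (z : F) := (z != 0) && root chi (T z).

Let Q0 : Q != 0. Proof. by rewrite (prim_root_eq0 Qn). Qed.
Let Qi0 i : Q ^+ i != 0. Proof. by rewrite expf_neq0. Qed.

Lemma horner_charpol z : z != 0 -> chi.[T z] = T (z ^+ n) - T (x ^+ n).
Proof.
move=> z0; rewrite horner_prod; under eq_bigr do rewrite hornerXsubC.
exact: prod_joukowski.
Qed.

Lemma in_spectrumM z : in_spectrum z -> in_spectrum (z * Q).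
Proof.
move=> /andP [z0]; rewrite /in_spectrum mulf_neq0 //= !rootE !horner_charpol ?mulf_neq0 //.
by rewrite exprMn (prim_expr_order Qn) mulr1.
Qed.

Lemma in_spectrumV z : in_spectrum z -> in_spectrum z^-1.
Proof. by rewrite /in_spectrum invr_eq0 joukowskiV. Qed.

Lemma in_spectrum_orbit i : in_spectrum (x * Q ^+ i).
Proof.
elim: i => [|i IH]; last by rewrite exprSr mulrA in_spectrumM.
by rewrite expr0 mulr1 /in_spectrum x0 rootE horner_charpol // subrr eqxx.
Qed.

Lemma in_spectrumP z : in_spectrum z -> exists i : 'I_n, T z = T (x * Q ^+ i).
Proof.
move=> /andP [z0]; rewrite rootE horner_prod => /prodf_eq0 [i _].
by rewrite hornerXsubC subr_eq0 => /eqP; exists i.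
Qed.

Lemma eigenrow_spectrum z : in_spectrum z -> e z *m A = T z *: e z.
Proof. by move=> /andP [_ /rootP]; exact: (eigenrow_mulA Qn y0 x0 wA w_delta w_n x_delta). Qed.

Lemma eigenrow_spectrum_uniq z (v : 'rV_n) : in_spectrum z ->
  v *m A = T z *: v -> exists s, v = s *: e z.
Proof. by move=> /andP [_ /rootP]; exact: (eigenrow_uniq Qn y0 x0 wA w_delta w_n x_delta). Qed.

Variable U : 'M[F]_n.
Hypotheses (UA : (U *m A <= U)%MS) (UB : (U *m B <= U)%MS).

(* No vector of U lies over [e z] in a Jordan block: T z is a simple eigenvalue of U. *)
Definition jordan_free (z : F) : bool := ~~ (e z <= U *m (A - (T z)%:M))%MS.

(** The functional is a column of the cokernel of [U (A - T z)]: all columns vanish on that image,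
    and one of them does not kill [e z]. *)
Lemma jordan_freeP z : jordan_free z -> exists2 p : 'cV[F]_n, e z *m p != 0 &
  forall u : 'rV_n, (u <= U)%MS -> u *m A *m p = T z *: (u *m p).
Proof.
rewrite /jordan_free submxE; set K := cokermx _ => /matrix0Pn [i [j Kij]].
exists (col j K).
  by apply: contraNneq Kij; rewrite colE mulmxA -colE => /matrixP /(_ i 0) /[!mxE] ->.
move=> u uU; apply/eqP; rewrite -subr_eq0 scalemxAl -mulmxBl -mul_mx_scalar -mulmxBr.
have uK : u *m (A - (T z)%:M) *m K = 0 by apply/eqP; rewrite -submxE submxMr.
by rewrite colE mulmxA uK mul0mx.
Qed.

(** [hpart n] is [chi], so the kernels of the [hpart t] at [A] exhaust the space, one eigenline of
    [A] at a time. *)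
Let hpart t : {poly F} := \prod_(i < t) ('X - (T (x * Q ^+ i))%:P).

Let hpartS t (v : 'rV_n) :
  v *m horner_mx A (hpart t.+1) = v *m horner_mx A (hpart t) *m (A - (T (x * Q ^+ t))%:M).
Proof. by rewrite /hpart big_ord_recr rmorphM mulmxA rmorphB /= horner_mx_X horner_mx_C. Qed.

Let hpartn (v : 'rV_n) : v *m horner_mx A (hpart n) = 0.
Proof.
rewrite [hpart n]/(chi) (charpol_mx Qn y0 x0 wA w_delta w_n x_delta).
by rewrite mulmx0.
Qed.

Let eig_of_sub t (v : 'rV_n) : v *m (A - (T t)%:M) = 0 -> v *m A = T t *: v.
Proof. by rewrite mulmxBr mul_mx_scalar => /eqP; rewrite subr_eq0 => /eqP. Qed.

(** For a nonzero [v] in [U], the last nonzero vector among the images of [v] under the [hpart t] is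
    an eigenvector of [A]. *)
Lemma exists_eigenrow_sub : U != 0 -> exists i, (e (x * Q ^+ i) <= U)%MS.
Proof.
move=> /rowV0Pn [v vU v0].
have := hpartn v; move: (X in hpart X) => m.
elim: m => [|t IH]; first by rewrite /hpart big_ord0 rmorph1 mulmx1 => /eqP; rewrite (negPf v0).
rewrite hpartS; have [/IH//|nz] := eqVneq (v *m horner_mx A (hpart t)) 0.
move=> /eig_of_sub /(eigenrow_spectrum_uniq (in_spectrum_orbit t)) [s sE].
exists t; have s0 : s != 0 by apply: contraNneq nz => s0; rewrite sE s0 scale0r.
rewrite -(scalerK s0 (e _)) scalemx_sub // -sE.
by apply: submx_trans (submxMr _ vU) _; apply: horner_mx_stable.
Qed.

(** Distinct mutually inverse points have the same [T], so this is the double eigenvalue of [A],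
    simple on [U], from which the walk starts. *)
Lemma exists_jordan_free :
    (forall i, (e (x * Q ^+ i) <= U)%MS) -> ~~ row_full U ->
  exists i j, [/\ x * Q ^+ i * (x * Q ^+ j) = 1, x * Q ^+ i != x * Q ^+ j
     & jordan_free (x * Q ^+ i)].
Proof.
move=> eU Ufull.
have coll t i : (i < t <= n)%N -> (t < n)%N -> T (x * Q ^+ t) = T (x * Q ^+ i) ->
    x * Q ^+ t * (x * Q ^+ i) = 1 /\ x * Q ^+ t != x * Q ^+ i.
  move=> /andP [it _] tn /eqP; rewrite eq_joukowski ?mulf_neq0 //.
  have ne : x * Q ^+ t != x * Q ^+ i.
    rewrite (inj_eq (mulfI x0)) (eq_prim_root_expr Qn) !modn_small //.
      by rewrite gtn_eqF.
    exact: ltn_trans it tn.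
  by rewrite (negPf ne) /= => /eqP.
pose bad := [exists t : 'I_n, exists i : 'I_n,
   [&& (i < t)%N, T (x * Q ^+ t) == T (x * Q ^+ i) & jordan_free (x * Q ^+ t)]].
have [/existsP [t /existsP [i /and3P [it /eqP Tti jt]]]|/existsPn good] := boolP bad.
  by exists t, i; have [] := coll t i; rewrite ?it ?(ltnW (ltn_ord t)) ?ltn_ord.
case/negP: Ufull; rewrite -sub1mx; apply/row_subP => l.
(* If every colliding eigenvalue had a Jordan block in U, then U would be everything. *)
suff ker t : (t <= n)%N -> forall v : 'rV_n, v *m horner_mx A (hpart t) = 0 -> (v <= U)%MS.
  by apply: (ker n).
elim: t => [_ v|t IH tn v].
  by rewrite /hpart big_ord0 rmorph1 mulmx1 => ->; rewrite sub0mx.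
rewrite hpartS => /eig_of_sub /(eigenrow_spectrum_uniq (in_spectrum_orbit t)) [s sE].
(* Lifting the eigenvector through [hpart t] inside [U] is enough: [v - s u] then falls under the
   induction hypothesis. *)
suff [u uU uE] : exists2 u : 'rV_n, (u <= U)%MS & u *m horner_mx A (hpart t) = e (x * Q ^+ t).
  rewrite -(subrK (s *: u) v) addmx_sub ?scalemx_sub // IH ?(ltnW tn) //.
  by rewrite mulmxBl sE -scalemxAl uE subrr.
have eA := eigenrow_spectrum (in_spectrum_orbit t).
have [/existsP [i /eqP Tti]|/existsPn nocoll] :=
    boolP [exists i : 'I_t, T (x * Q ^+ t) == T (x * Q ^+ i)].
  have := good (Ordinal tn) => /existsPn /(_ (Ordinal (ltn_trans (ltn_ord i) tn))).
  rewrite /= ltn_ord Tti eqxx /= negbK -Tti => /submxP [D DE].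
  pose f := D *m U; have fE : f *m (A - (T (x * Q ^+ t))%:M) = e (x * Q ^+ t).
    by rewrite -mulmxA.
  pose h' := \prod_(k < t | k != i) ('X - (T (x * Q ^+ k))%:P).
  have hE : hpart t = ('X - (T (x * Q ^+ i))%:P) * h' by rewrite /hpart (bigD1 i).
  (* No second index [k] collides with [t]: both [x Q^i] and [x Q^k] would be the inverse of
     [x Q^t]. *)
  have h0 : h'.[T (x * Q ^+ t)] != 0.
    rewrite horner_prod; apply/prodf_neq0 => k ki; rewrite hornerXsubC subr_eq0.
    apply: contraNneq ki => Ttk.
    have [] := coll t i; rewrite ?ltn_ord ?(ltnW tn) // => ti _.
    have [] := coll t k; rewrite ?ltn_ord ?(ltnW tn) // -ti => tk _.
    have tx : x * Q ^+ t * x != 0 by rewrite !mulf_neq0.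
    move: tk; rewrite !mulrA => /(mulfI tx) /eqP.
    rewrite (eq_prim_root_expr Qn) !modn_small ?(ltn_trans (ltn_ord _) tn) //.
  exists ((h'.[T (x * Q ^+ t)])^-1 *: f); first by rewrite scalemx_sub ?submxMl.
  rewrite -scalemxAl hE rmorphM /= mulmxA rmorphB /= horner_mx_X horner_mx_C.
  by rewrite -Tti fE (eigenrow_horner _ eA) scalerK.
have h0 : (hpart t).[T (x * Q ^+ t)] != 0.
  rewrite horner_prod; apply/prodf_neq0 => k _; rewrite hornerXsubC subr_eq0.
  exact: nocoll.
exists (((hpart t).[T (x * Q ^+ t)])^-1 *: e (x * Q ^+ t)); first by rewrite scalemx_sub.
by rewrite -scalemxAl (eigenrow_horner _ eA) scalerK.
Qed.

Let Qpow m : (Q ^+ m == 1) = (n %| m)%N.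
Proof. by rewrite (prim_order_dvd Qn). Qed.
Let Q1 : Q != 1.
Proof. by rewrite -[Q]expr1 Qpow gtnNdvd // (ltn_trans _ n2). Qed.
Let QQ1 : Q * Q != 1.
Proof. by rewrite -expr2 Qpow gtnNdvd. Qed.

Let TQ_add z : z != 0 -> T (z / Q) + T (z * Q) = (Q + Q^-1) * T z.
Proof. by move=> z0; rewrite /T; field; rewrite z0 Q0. Qed.
Let TQ_mul z : z != 0 -> T (z / Q) * T (z * Q) = T z ^+ 2 + (Q - Q^-1) ^+ 2.
Proof. by move=> z0; rewrite /T; field; rewrite z0 Q0. Qed.

Let TQ_neq z : z != 0 -> z * (z * Q) != 1 -> T z != T (z * Q).
Proof.
move=> z0 zQ; rewrite eq_joukowski ?mulf_neq0 // negb_or zQ andbT.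
by rewrite -{1}[z]mulr1 (inj_eq (mulfI z0)) eq_sym.
Qed.

Definition marginal z := exists kappa, e z *m B *m (A - (T (z * Q))%:M) = kappa *: e z.

(** [e z] and [e z^-1] coincide, and inversion exchanges the neighbours [T (z / Q)] and
    [T (z Q)]. *)
Let marginalV z : in_spectrum z -> (e z <= U)%MS ->
    (exists kappa, e z *m B *m (A - (T (z / Q))%:M) = kappa *: e z) ->
  exists z', [/\ in_spectrum z', (e z' <= U)%MS & marginal z'].
Proof.
move=> zs eU [k kE]; exists z^-1; split; first exact: in_spectrumV.
  by rewrite joukowskiV.
exists k; rewrite joukowskiV -kE; congr (_ *m (A - (_)%:M)).
by rewrite -joukowskiV invfM invrK.
Qed.

Lemma exists_marginal : U != 0 -> ~~ row_full U ->
  exists z, [/\ in_spectrum z, (e z <= U)%MS & marginal z].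
Proof.
move=> /exists_eigenrow_sub [i ei] Ufull.
have [eU|] := boolP [forall k : 'I_n, (e (x * Q ^+ k) <= U)%MS]; last first.
  rewrite negb_forall => /existsP [k ek].
  (* The walk starts at [x Q^i], inside [U], and ends at [x Q^k], outside, because
     [i + (k + n' i) = k + n i]. *)
  have [||m /andP [em em1]] := @exists_last_step
      (fun m => (e (x * Q ^+ (i + m)) <= U)%MS) (k + n' * i).
  - by rewrite addn0.
  - by rewrite addnCA -mulSn exprD [Q ^+ (_ * _)]exprM (prim_expr_order Qn) expr1n mulr1.
  move: em1; rewrite addnS exprSr mulrA; set z := x * _ in em * => em1.
  have zs : in_spectrum z by apply: in_spectrum_orbit.
  have z0 : z != 0 by case/andP: zs.
  apply: (marginalV zs em).
  apply: (marginal_of_missing AAB UA UB em (eigenrow_spectrum zs) (y := T (z * Q))).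
  - by rewrite addrC TQ_add.
  - by rewrite mulrC TQ_mul.
  - by apply: contraNneq em1 => <-.
  move=> u uU /(eigenrow_spectrum_uniq (in_spectrumM zs)) [s uE].
  have [s0|s0] := eqVneq s 0; first by rewrite uE s0 scale0r.
  by case/negP: em1; rewrite -(scalerK s0 (e _)) scalemx_sub // -uE.
have {}eU z : in_spectrum z -> (e z <= U)%MS.
  by move=> /in_spectrumP [k ->]; apply: (forallP eU).
have [] := exists_jordan_free _ Ufull; first by move=> k; apply/eU/in_spectrum_orbit.
move=> {ei}i [j []]; set z0 := x * _; set z1 := x * _ => z01 z0z1 jz0.
(* Adding [n' i] stands for subtracting [i] modulo [n]; thus [z0 Q^m = z1 = 1/z0]. *)
pose m := (j + n' * i)%N.
have z1E : z1 = z0 * Q ^+ m.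
  rewrite /z0 -mulrA -exprD /m addnCA -mulSn exprD [Q ^+ (_ * _)]exprM.
  by rewrite (prim_expr_order Qn) expr1n mulr1.
have zs k : in_spectrum (z0 * Q ^+ k).
  by rewrite /z0 -mulrA -exprD; apply: in_spectrum_orbit.
have zn0 k : z0 * Q ^+ k != 0 by case/andP: (zs k).
pose G k := jordan_free (z0 * Q ^+ k) && (z0 * Q ^+ k * (z0 * Q ^+ k) != 1).
have G0 : G 0%N.
  rewrite /G expr0 mulr1 jz0 -z01 (inj_eq (mulfI _)) //.
  by have := zn0 0%N; rewrite expr0 mulr1.
(* As [z0 * z0 Q^m = 1], the midpoint [z] satisfies [z^2 = 1] if [m] is even, which [G] excludes,
   and [z^2 Q = 1] if [m] is odd, a loop [T z = T (z Q)]. *)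
have [Gs|Gs] := boolP (G m./2).
  have /andP [jz zz] := Gs.
  have mE := odd_double_half m; case: (odd m) mE => mE; last first.
    case/eqP: zz; rewrite mulrACA -exprD addnn -[_.*2]add0n mE.
    by rewrite -z01 z1E mulrA.
  set z := z0 * _ in jz zz.
  have zzQ : z * (z * Q) = 1.
    have -> : z * (z * Q) = z0 * (z0 * (Q ^+ m./2 * Q ^+ m./2 * Q)) by rewrite /z; ring.
    by rewrite -exprD addnn -exprSr -[_.+1]add1n mE -z1E.
  have [p ep pU] := jordan_freeP jz.
  apply: (marginalV (zs _) (eU _ (zs _))).
  apply: (marginal_of_loop AAB UA UB (eU _ (zs _)) (eigenrow_spectrum (zs _)) (y := T (z * Q)) _ _ _ _ pU ep).
  - by rewrite addrC TQ_add.
  - by rewrite mulrC TQ_mul.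
  - by apply/eqP; rewrite eq_joukowski ?mulf_neq0 // zzQ eqxx orbT.
  by move=> u; apply/eigenrow_spectrum_uniq/zs.
have [k /andP [/andP [jz zz]]] := exists_last_step G0 Gs.
rewrite /G exprSr mulrA; set z := z0 * _ in jz zz * => nG.
have zQs : in_spectrum (z * Q) by apply/in_spectrumM/zs.
have z_0 : z != 0 by apply: zn0.
have zQ_0 : z * Q != 0 by rewrite mulf_neq0.
have [p ep pU] := jordan_freeP jz.
(* The vector is taken at [z Q], one step past the last good point [z]; its neighbour [T z] carries
   the functional [p]. *)
exists (z * Q); split=> //; first exact: eU.
have ad : T z + T (z * Q * Q) = (Q + Q^-1) * T (z * Q).
  by rewrite -TQ_add // mulfK.
have mu : T z * T (z * Q * Q) = T (z * Q) ^+ 2 + (Q - Q^-1) ^+ 2.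
  by rewrite -TQ_mul // mulfK.
suff [xy pB] : T (z * Q) != T z /\ (T z - T (z * Q * Q)) *: (e (z * Q) *m B *m p) = 0.
  rewrite /marginal; have eig u : u *m A = T z *: u -> exists s, u = s *: e z.
    exact: (eigenrow_spectrum_uniq (zs k)).
  exact: (marginal_of_functional AAB UB (eU _ zQs) (eigenrow_spectrum zQs) ad mu xy eig pU ep pB).
(* At a fixed point [(z Q)^2 = 1] the two neighbours of [T (z Q)] coincide, so the factor
   [T z - T (z Q^2)] is 0. *)
have [/eqP zQ1|zQ1] := boolP (z * Q * (z * Q) == 1).
  split.
    rewrite eq_sym TQ_neq //; apply: contraNneq Q1 => zzQ.
    by rewrite -(inj_eq (mulfI (mulf_neq0 z_0 zQ_0))) mulr1 {2}zzQ -zQ1; apply/eqP; ring.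
  have /eqP -> : T z == T (z * Q * Q).
    rewrite eq_joukowski ?mulf_neq0 //; apply/orP; right; apply/eqP.
    by rewrite -zQ1; ring.
  by rewrite subrr scale0r.
move: nG; rewrite zQ1 andbT negbK => eQ.
(* [jordan_free] sees its argument only through [T], and it holds at [z] but not at [z Q]. *)
have xy : T (z * Q) != T z.
  by apply: contraNneq jz => Tzz; rewrite -Tzz.
split=> //; move: eQ => /submxP [D DE].
suff -> : e (z * Q) *m B *m p = 0 by rewrite scaler0.
apply: (jordan_functional AAB UA UB (eU _ zQs) (eigenrow_spectrum zQs) ad mu (f := D *m U) xy) => //.
- exact: submxMl.
- by rewrite DE mulmxA mulmxBr mul_mx_scalar addrC subrK.
(* Since [beta * T z = T (z / Q) + T (z Q)], the inequality reduces to [T (z / Q) != T (z Q)], that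
   is, to [Q^2 != 1] and [z^2 != 1]: here [n > 2] and the second half of [G k] enter. *)
rewrite -TQ_add // mulr_natl mulr2n (inj_eq (addIr _)).
rewrite eq_joukowski ?mulf_neq0 ?invr_eq0 // negb_or; apply/andP; split.
  rewrite -(inj_eq (mulIf Q0)) divfK // -mulrA -{1}[z]mulr1 (inj_eq (mulfI z_0)) eq_sym.
  exact: QQ1.
by have -> : z / Q * (z * Q) = z * z by field; rewrite ?Q0.
Qed.
End ProperSubmodule.

(** * Lowering by [B] into the line of [w 0] *)

Definition lowering (F : fieldType) (n : nat) (B : 'M[F]_n) (ts : nat -> F)
    (v : 'rV[F]_n) (k : nat) : 'rV[F]_n :=
  foldl (fun v h => v *m (B - (ts (n - h)%N)%:M)) v (iota 1 k).

Section Lowering.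
Variables (F : fieldType) (n : nat) (B : 'M[F]_n) (ts f : nat -> F) (w : nat -> 'rV[F]_n).
Hypotheses (n0 : (0 < n)%N) (f0 : f 0%N = 0).
Hypothesis wB : forall i, w i *m B = ts i *: w i + f i *: w i.-1.
Hypothesis w_delta : forall k : 'I_n, w k = delta_mx 0 k.

Lemma loweringS (v : 'rV_n) k :
  lowering B ts v k.+1 = lowering B ts v k *m (B - (ts (n - k.+1)%N)%:M).
Proof.
rewrite /lowering; have -> : iota 1 k.+1 = iota 1 k ++ [:: k.+1] by rewrite -[in LHS](addn1 k) iotaD.
by rewrite foldl_cat.
Qed.

Lemma lowering_sub (U : 'M[F]_n) (v : 'rV_n) k : (U *m B <= U)%MS ->
  (v <= U)%MS -> (lowering B ts v k <= U)%MS.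
Proof.
move=> UB vU; elim: k => // k IH; rewrite loweringS mulmxBr mul_mx_scalar.
rewrite addmx_sub ?eqmx_opp ?scalemx_sub //.
exact: submx_trans (submxMr B IH) UB.
Qed.

(** After [k] factors only coordinates below [n - k] survive: the next factor annihilates the
    diagonal entry of the top one, and [B] never raises an index. *)
Lemma lowering_support (v : 'rV_n) k (l : 'I_n) : (k <= n)%N -> (n - k <= l)%N ->
  lowering B ts v k 0 l = 0.
Proof.
elim: k l => [|k IH] l kn; first by rewrite subn0 leqNgt ltn_ord.
move=> nl; rewrite loweringS; set u := lowering _ _ _ _ in IH *.
have uE : u = \sum_j u 0 j *: w j.
  by rewrite [LHS]row_sum_delta; apply: eq_bigr => j _; rewrite w_delta.
rewrite uE mulmx_suml summxE big1 // => j _.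
have [jk|jk] := leqP (n - k) j; first by rewrite IH ?scale0r ?mul0mx ?mxE // ltnW.
have jm : (j <= n - k.+1)%N by rewrite subnS -ltnS prednK // subn_gt0.
rewrite -scalemxAl mulmxBr mul_mx_scalar wB addrAC -scalerBl !mxE.
have wl i : (i < n)%N -> i != l -> w i 0 l = 0.
  move=> iN; have := w_delta (Ordinal iN); move=> /= -> il.
  by rewrite mxE -[l == _]val_eqE /= eq_sym (negPf il).
have -> : (ts j - ts (n - k.+1)%N) * w j 0 l = 0.
  have [jE|jl] := eqVneq (j : nat) l; last by rewrite wl ?mulr0.
  suff -> : (j : nat) = (n - k.+1)%N by rewrite subrr mul0r.
  by apply/eqP; rewrite eqn_leq jm jE.
suff -> : f j * w j.-1 0 l = 0 by rewrite addr0 mulr0.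
case jE : (j : nat) => [|i]; first by rewrite f0 mul0r.
rewrite wl ?mulr0 //=; first by apply: ltn_trans (ltn_ord j); rewrite jE.
by rewrite ltn_eqF // (leq_trans _ nl) // -jE.
Qed.

Lemma lowering_w0 (v : 'rV_n) : exists s, lowering B ts v n.-1 = s *: w 0%N.
Proof.
have := w_delta (Ordinal n0); move=> /= w0E.
exists (lowering B ts v n.-1 0 (Ordinal n0)); rewrite w0E.
apply/rowP => l; rewrite !mxE -[l == _]val_eqE /=.
have [l0|l0] := eqVneq (l : nat) 0%N.
  by rewrite mulr1; congr (lowering _ _ _ _ _ _); apply: val_inj.
rewrite mulr0 lowering_support ?leq_pred //.
by rewrite -subn1 subKn // lt0n.
Qed.
End Lowering.

(** * The submodule generated by a marginal vector *)

Section KrylovSubmodule.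
Variables (F : fieldType) (n : nat) (A B : 'M[F]_n) (ts : nat -> F).
Variables (beta rho s0 s1 : F).
Hypothesis n0 : (0 < n)%N.
Hypothesis BBA : A *m B *m B + B *m B *m A + rho *: A
  = beta *: (B *m A *m B) + s0%:M + s1 *: B.

Lemma krylov_submodule (e : 'rV[F]_n) (t s k : F) : e != 0 ->
    e *m A = t *: e -> e *m B *m (A - s%:M) = k *: e -> lowering B ts e n.-1 = 0 ->
  exists U : 'M[F]_n, [/\ U != 0, ~~ row_full U, (U *m A <= U)%MS & (U *m B <= U)%MS].
Proof.
move=> e0 eA eBA Le.
(* The last row of this matrix is 0. *)
pose v := lowering B ts e; pose U := \matrix_(i < n) v i.
have vS i : v i *m B = v i.+1 + ts (n - i.+1)%N *: v i.
  by rewrite /v loweringS mulmxBr mul_mx_scalar subrK.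
have vn : v n.-1 = 0 by [].
have vU i : (i < n)%N -> (v i <= U)%MS.
  by move=> iN; rewrite -[v i](rowK v (Ordinal iN)) row_sub.
have eU : (e <= U)%MS by apply: (vU 0%N).
have UB : (U *m B <= U)%MS.
  apply/row_subP => i; rewrite row_mul rowK vS.
  have [iN|iN] := ltnP i.+1 n; first by rewrite addmx_sub ?scalemx_sub ?vU.
  have -> : (i : nat) = n.-1.
    by apply/eqP; rewrite eqn_leq -ltnS -(ltnS n.-1) prednK // ltn_ord.
  by rewrite -vS vn mul0mx sub0mx.
have UBr (u : 'rV_n) : (u <= U)%MS -> (u *m B <= U)%MS.
  by move=> uU; apply: submx_trans (submxMr B uU) UB.
exists U; split=> //.
- by apply: contraNneq e0 => U0; move: eU; rewrite U0 submx0.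
- rewrite -[row_full U]/(\rank U == n) -[\rank U == n]/(row_free U).
  apply/negP => /row_freeP [V UV].
  have nn : (n.-1 < n)%N by rewrite prednK.
  have := congr1 (row (Ordinal nn)) UV; rewrite row_mul rowK vn mul0mx => /esym /rowP.
  move=> /(_ (Ordinal nn)); rewrite !mxE eqxx => /eqP.
  by rewrite oner_eq0.
(* The induction carries [v i *m B *m A] along, because [BBA] expresses [v i *m B *m B *m A] through
   [v i], [v i *m A], [v i *m B *m A] and their images under powers of [B]. Marginality of [e] is
   the base case. *)
suff vA i : (i < n)%N -> (v i *m A <= U)%MS /\ (v i *m B *m A <= U)%MS.
  by apply/row_subP => i; rewrite row_mul rowK; have [] := vA i.
elim: i => [_|i IH iN].
  rewrite /v /lowering /= eA; split; first by rewrite scalemx_sub.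
  have -> : e *m B *m A = s *: (e *m B) + k *: e.
    by rewrite -eBA mulmxBr mul_mx_scalar addrC subrK.
  by rewrite addmx_sub ?scalemx_sub ?UBr.
have [vA vBA] := IH (ltnW iN); have vi := vU _ (ltnW iN).
have -> : v i.+1 = v i *m B - ts (n - i.+1)%N *: v i by rewrite vS addrK.
split; first by rewrite mulmxBl -scalemxAl addmx_sub ?eqmx_opp ?scalemx_sub.
rewrite !mulmxBl -!scalemxAl addmx_sub ?eqmx_opp ?scalemx_sub //.
have := congr1 (mulmx (v i)) BBA; rewrite !mulmxDr -!scalemxAr !mulmxA mul_mx_scalar.
move/(canRL (addrK _))/(canRL (addKr _)) => ->.
by rewrite !addmx_sub ?eqmx_opp ?scalemx_sub ?UBr // ?addmx_sub ?scalemx_sub ?UBr.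
Qed.
End KrylovSubmodule.

(** * The reducibility criterion for an abstract pair [A], [B] *)

Section Reducibility.
Variables (F : closedFieldType) (n : nat) (Q y x delta : F) (A B : 'M[F]_n).
Variables (ts f : nat -> F) (w : nat -> 'rV[F]_n).
Hypotheses (Qn : n.-primitive_root Q) (y0 : y != 0) (x0 : x != 0) (n2 : (2 < n)%N).
Hypothesis wA : forall i, w i *m A = joukowski (y * Q ^+ i) *: w i + w i.+1.
Hypothesis wB : forall i, w i *m B = ts i *: w i + f i *: w i.-1.
Hypothesis f0 : f 0%N = 0.
Hypothesis w_delta : forall k : 'I_n, w k = delta_mx 0 k.
Hypothesis w_n : w n = delta *: w 0%N.
Hypothesis x_delta : joukowski (x ^+ n) = delta + joukowski (y ^+ n).
Variables (r0 r1 s0 s1 : F).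
Hypothesis AAB : B *m A *m A + A *m A *m B + (Q - Q^-1) ^+ 2 *: B
  = (Q + Q^-1) *: (A *m B *m A) + r0%:M + r1 *: A.
Hypothesis BBA : A *m B *m B + B *m B *m A + (Q - Q^-1) ^+ 2 *: A
  = (Q + Q^-1) *: (B *m A *m B) + s0%:M + s1 *: B.

Local Notation e i := (eigenrow n Q y (joukowski (x * Q ^+ i))).

Lemma eigenrow_eigen i :
  e i != 0 /\ e i *m A = joukowski (x * Q ^+ i) *: e i.
Proof.
move: A B w Qn n2 wA wB w_delta w_n x_delta AAB BBA.
case: n => // n' A' B' w' Qn' n2' wA' wB' wd' wn' xd' _ _.
split; first exact: eigenrow_neq0.
exact: (eigenrow_spectrum Qn' y0 x0 wA' wd' wn' xd' (in_spectrum_orbit Qn' x0 i)).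
Qed.

Lemma reducibleP :
  (exists U : 'M[F]_n, [/\ U != 0, ~~ row_full U, (U *m A <= U)%MS & (U *m B <= U)%MS]) <->
  exists i : 'I_n,
    (exists mu kappa, [/\ mu != 0, joukowski mu = joukowski (x * Q ^+ i)
      & e i *m B *m (A - (joukowski (mu * Q))%:M) = kappa *: e i])
    /\ lowering B ts (e i) n.-1 = 0.
Proof.
split=> [|[i [[mu [k [mu0 muE eBA]]] Le]]]; last first.
  have [e0 eA] := eigenrow_eigen i.
  exact: (krylov_submodule (ltnW (ltnW n2)) BBA e0 eA eBA Le).
have n0 : (0 < n)%N by rewrite (ltnW (ltnW n2)).
have Lw0 := lowering_w0 n0 f0 wB w_delta.
have Lsub := @lowering_sub F n B ts.
move: A B w Qn n2 wA wB w_delta w_n x_delta AAB BBA Lw0 Lsub {n0}.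
case: n => // n' A' B' w' Qn' n2' wA' wB' wd' wn' xd' AAB' BBA' Lw0 Lsub.
move=> [U [U0 Ufull UA UB]].
have [z [zs eU [k eBA]]] := exists_marginal Qn' y0 x0 n2' wA' wd' wn' xd' AAB' UA UB U0 Ufull.
have [i zE] := in_spectrumP zs.
exists i; split; first by exists z, k; rewrite -zE; case/andP: zs.
(* The lowered vector is [s *: w 0] and lies in [U]; if [s != 0] then [w 0] is in [U], and [A]
   produces every [w m] from it, against properness. *)
rewrite -zE; have [s sE] := Lw0 (eigenrow n'.+1 Q y (joukowski z)).
have [s0'|sn0] := eqVneq s 0; first by rewrite sE s0' scale0r.
case/negP: Ufull; rewrite -sub1mx; apply/row_subP => j; rewrite rowE mulmx1 -wd'.
elim: (j : nat) => [|m IH].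
  by rewrite -(scalerK sn0 (w' 0%N)) scalemx_sub // -sE Lsub.
have -> : w' m.+1 = w' m *m A' - joukowski (y * Q ^+ m) *: w' m.
  by rewrite wA' addrAC subrr add0r.
rewrite addmx_sub ?eqmx_opp ?scalemx_sub //.
exact: submx_trans (submxMr A' IH) UA.
Qed.
End Reducibility.

(** * The order [d'] of [q^2] *)

Lemma dp_primitive_root (F : closedFieldType) (q : F) (d : nat) :
  d.-primitive_root q -> (dp d).-primitive_root (q ^+ 2).
Proof.
move=> qd; suff -> : dp d = (d %/ gcdn 2 d)%N by apply: exp_prim_root.
rewrite /dp; have [od|ed] := boolP (odd d).
  by move: od; rewrite -coprime2n /coprime => /eqP ->; rewrite divn1.
have /gcdn_idPl -> : (2 %| d)%N by rewrite dvdn2.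
by rewrite divn2.
Qed.

Lemma dp_gt2 (d : nat) : (0 < d)%N -> d \notin [:: 1%N; 2%N; 4%N] -> (2 < dp d)%N.
Proof. by rewrite /dp; case: d => [|[|[|[|[|[|d]]]]]] //= _ _; case: ifP. Qed.

(** * The matrices of the module as an instance *)

Section Instance.
Variables (F : closedFieldType) (q : F) (d : nat) (a b c lam delta nu : F).
Hypotheses (q0 : q != 0) (a0 : a != 0) (b0 : b != 0) (c0 : c != 0) (lam0 : lam != 0).
Local Notation Q := (q ^+ 2).
Local Notation n := (dp d).
Hypotheses (Qn : n.-primitive_root Q) (n0 : (0 < n)%N).

Lemma exprz_double (i : nat) : q ^ (2 * i%:Z) = Q ^+ i.
Proof. by rewrite -PoszM -exprM. Qed.

Lemma joukowski_exprz (u : F) (i : nat) :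
  joukowski (u * Q ^+ i) = u * q ^ (2 * i%:Z) + u^-1 * q ^ (- (2 * i%:Z)).
Proof. by rewrite /joukowski -invr_expz exprz_double invfM. Qed.

Lemma thetaE i : theta q a lam i = joukowski (a / lam * Q ^+ i).
Proof. by rewrite joukowski_exprz invf_div. Qed.

Lemma theta_sE i : theta_s q b lam i = joukowski (b / lam * Q ^+ i).
Proof. by rewrite joukowski_exprz invf_div. Qed.

Lemma vthetaE i : vtheta q nu i = joukowski (nu^-1 * Q ^+ i).
Proof. by rewrite joukowski_exprz invrK. Qed.

(** Each of the four differences in [phi] is odd in [q^i], so their product depends only on
    [q^(2i)]. *)
Lemma phiE i : phi q a b c lam i = split_phi q a b c lam (Q ^+ i).
Proof.
rewrite /phi /split_phi -[1 - i%:Z]opprB -!invr_expz !expfzDr // -!invr_expz expr1z.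
rewrite [Q ^+ i]exprAC -!exprnP; have : q ^+ i != 0 by rewrite expf_neq0.
move: (q ^+ i) => t t0; field.
by rewrite q0 a0 b0 c0 lam0 t0.
Qed.

Lemma evecE i : evec q d a lam nu i = eigenrow n Q (a / lam) (joukowski (nu^-1 * Q ^+ i)).
Proof.
apply/rowP => k; rewrite !mxE; apply: eq_bigr => j _.
by rewrite vthetaE thetaE.
Qed.

(* The image of m_i in W, for every natural number i. *)
Definition cyc_row (i : nat) : 'rV[F]_n :=
  \row_j (delta ^+ (i %/ n) * (j == i %% n :> nat)%N%:R).

Lemma cyc_row_delta (k : 'I_n) : cyc_row k = delta_mx 0 k.
Proof.
by apply/rowP => j; rewrite !mxE divn_small // modn_small // mul1r.
Qed.

Lemma cyc_row_n : cyc_row n = delta *: cyc_row 0.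
Proof.
by apply/rowP => j; rewrite !mxE divnn n0 modnn div0n mod0n expr1 mul1r.
Qed.

Let modI (i : nat) : 'I_n := Ordinal (ltn_pmod i n0).

Lemma cyc_rowE i : cyc_row i = delta ^+ (i %/ n) *: delta_mx 0 (modI i).
Proof. by apply/rowP => j; rewrite !mxE -[j == modI i]val_eqE. Qed.

Lemma Q_mod i : Q ^+ (i %% n) = Q ^+ i.
Proof. exact: prim_expr_mod. Qed.

Lemma cyc_row_A i : cyc_row i *m Amat q d a lam delta
  = joukowski (a / lam * Q ^+ i) *: cyc_row i + cyc_row i.+1.
Proof.
rewrite cyc_rowE -scalemxAl -rowE; apply/rowP => j; rewrite !mxE /=.
rewrite thetaE Q_mod -[modI i == j]val_eqE /= [_ == _ :> nat]eq_sym.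
rewrite mulrDr; congr (_ + _); first by ring.
have iE := divn_eq i n; have iN := ltn_pmod i n0.
case: ltnP => [i1|i1].
  have -> : (i.+1 %/ n = i %/ n)%N.
    by rewrite {1}iE -addnS divnMDl // (divn_small i1) addn0.
  by have -> : (i.+1 %% n = (i %% n).+1)%N by rewrite {1}iE -addnS modnMDl modn_small.
(* At the last residue the exponent of [delta] in [cyc_row] grows by one, matching the corner entry
   of [Amat]. *)
have i1E : (i %% n).+1 = n by apply/eqP; rewrite eqn_leq i1 iN.
have iSE : i.+1 = ((i %/ n).+1 * n)%N by rewrite {1}iE -addnS i1E mulSn addnC.
by rewrite iSE mulnK // modnMl exprSr -!mulrA [delta * _]mulrC.
Qed.

Lemma split_phi1 : split_phi q a b c lam 1 = 0.
Proof. by rewrite /split_phi invr1 subrr mul0r mulr0 mul0r. Qed.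

Lemma cyc_row_B i : cyc_row i *m Bmat q d a b c lam
  = theta_s q b lam i *: cyc_row i + split_phi q a b c lam (Q ^+ i) *: cyc_row i.-1.
Proof.
rewrite [X in X *m _]cyc_rowE -scalemxAl -rowE; apply/rowP => j; rewrite !mxE /=.
rewrite !theta_sE phiE Q_mod -[modI i == j]val_eqE /= [_ == _ :> nat]eq_sym.
rewrite mulrDr; congr (_ + _); first by ring.
(* When [n] divides [i], [Q^i = 1] and [split_phi] vanishes, so the value of [i.-1], including
   [0.-1 = 0], does not matter. *)
have [i0|i0] := eqVneq (i %% n)%N 0%N.
  by rewrite -(Q_mod i) i0 expr0 split_phi1 !mulr0 [RHS]mul0r.
have iE := divn_eq i n; have iN := ltn_pmod i n0.
have i1E : i.-1 = (i %/ n * n + (i %% n).-1)%N.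
  by rewrite {1}iE -subn1 -addnBA ?lt0n // subn1.
have i1N : ((i %% n).-1 < n)%N by apply: leq_ltn_trans iN; apply: leq_pred.
rewrite i1E divnMDl // (divn_small i1N) addn0 modnMDl (modn_small i1N).
have -> : (j.+1 == i %% n)%N = (j == (i %% n).-1 :> nat).
  by rewrite -[in LHS](prednK (n := i %% n)) ?lt0n // eqSS.
by ring.
Qed.

Lemma cyc_row_inj (M : 'M[F]_n) : (forall i, cyc_row i *m M = 0) -> M = 0.
Proof.
by move=> M0; apply/row_matrixP => i; rewrite row0 rowE -cyc_row_delta.
Qed.

Lemma coef_cyc_row0 (s : F) : coef_w0 (s *: cyc_row 0) = s.
Proof.
rewrite /coef_w0 (big_pred1 (Ordinal n0)) => [|k]; last by [].
by rewrite !mxE /= div0n mod0n !mulr1.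
Qed.
End Instance.

Theorem theorem8p9 (F : closedFieldType) (q : F) (d : nat)
    (a b c lam delta nu : F) :
  d.-primitive_root q -> d \notin [:: 1%N; 2%N; 4%N] ->
  a != 0 -> b != 0 -> c != 0 -> lam != 0 -> nu != 0 ->
  nu ^+ dp d + nu ^- dp d
    = delta + a ^+ dp d / lam ^+ dp d + lam ^+ dp d / a ^+ dp d ->
  W_reducible q d a b c lam delta <->
  exists i : 'I_(dp d),
    (exists mu : F, mu != 0 /\
       evec q d a lam nu i *m Amat q d a lam delta = (mu + mu^-1) *: evec q d a lam nu i /\
       is_eigvec (Bmat q d a b c lam *m (Amat q d a lam delta - (mu * q ^+ 2 + mu^-1 * q ^- 2)%:M))
                 (evec q d a lam nu i))
    /\ Lcoef q d a b c lam nu i = 0.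
Proof.
move=> qd d124 a0 b0 c0 lam0 nu0 nuE.
have Qn := dp_primitive_root qd.
have n2 := dp_gt2 (prim_order_gt0 qd) d124.
have n0 : (0 < dp d)%N := prim_order_gt0 Qn.
have q0 : q != 0 by rewrite (prim_root_eq0 qd) -lt0n (prim_order_gt0 qd).
have y0 : a / lam != 0 by rewrite mulf_neq0 ?invr_eq0.
have x0 : nu^-1 != 0 by rewrite invr_eq0.
have wA := cyc_row_A a lam delta Qn n0.
have wB := cyc_row_B delta q0 a0 b0 c0 lam0 Qn n0.
have w_delta := @cyc_row_delta F d delta.
have w_n := @cyc_row_n F d delta n0.
have w_inj := @cyc_row_inj F d delta.
(* The condition imposed on [nu], read for [x = 1/nu] and [y = a / lam]. *)
have x_delta : joukowski (nu^-1 ^+ dp d) = delta + joukowski ((a / lam) ^+ dp d).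
  by rewrite exprVn joukowskiV /joukowski nuE !(exprMn, exprVn) invf_div addrA.
have f0 : split_phi q a b c lam (q ^+ 2 ^+ 0) = 0 by rewrite expr0 split_phi1.
have wB' i : cyc_row d delta i *m Bmat q d a b c lam
  = joukowski (b / lam * q ^+ 2 ^+ i) *: cyc_row d delta i
    + split_phi q a b c lam (q ^+ 2 ^+ i) *: cyc_row d delta i.-1.
  by rewrite wB theta_sE.
have AAB := askey_wilson_AAB q0 a0 b0 c0 lam0 wA wB' w_inj.
have BBA := askey_wilson_BBA q0 a0 b0 c0 lam0 wA wB' w_inj.
have red := reducibleP Qn y0 x0 n2 wA wB (f := fun i => split_phi q a b c lam (q ^+ 2 ^+ i)) f0 w_delta w_n x_delta AAB BBA.
have eig i : evec q d a lam nu i != 0 /\ evec q d a lam nu i *m Amat q d a lam delta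
    = joukowski (nu^-1 * q ^+ 2 ^+ i) *: evec q d a lam nu i.
  rewrite evecE.
  exact: (eigenrow_eigen Qn y0 x0 n2 wA wB w_delta w_n x_delta AAB BBA).
(* The lowered vector is a multiple of [w_0], so it vanishes as soon as its coefficient there
   does. *)
have Lw i : Lcoef q d a b c lam nu i = 0 <->
   lowering (Bmat q d a b c lam) (theta_s q b lam) (evec q d a lam nu i) (dp d).-1 = 0.
  rewrite -[Lcoef _ _ _ _ _ _ _ _]/(coef_w0 (lowering _ _ _ _)).
  have [s ->] := lowering_w0 n0 f0 wB w_delta (evec q d a lam nu i).
  rewrite coef_cyc_row0 //; split=> [->|sw]; first by rewrite scale0r.
  by rewrite -(coef_cyc_row0 delta n0 s) sw -(scale0r (cyc_row d delta 0)) coef_cyc_row0.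
have muQ mu : mu * q ^+ 2 + mu^-1 * q ^- 2 = joukowski (mu * q ^+ 2).
  by rewrite /joukowski [(mu * _)^-1]invfM.
split.
  move=> [U [Ur Un UA UB _]].
  have /red [i [[mu [kappa [mu0 muE eBA]]] Le]] : exists U : 'M[F]_(dp d),
      [/\ U != 0, ~~ row_full U, (U *m Amat q d a lam delta <= U)%MS
        & (U *m Bmat q d a b c lam <= U)%MS].
    by exists U; split=> //; rewrite -mxrank_eq0.
  have [e0 eA] := eig i; exists i; split; last by apply/Lw; rewrite evecE.
  exists mu; split=> //; split; first by rewrite eA -muE.
  by split=> //; exists kappa; rewrite muQ mulmxA evecE.
move=> [i [[mu [mu0 [eA' [_ [kappa eBA]]]]] Le]].
have [e0 eA] := eig i.
have /red [U [U0 Un UA UB]] : exists i : 'I_(dp d),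
    (exists mu kappa, [/\ mu != 0, joukowski mu = joukowski (nu^-1 * q ^+ 2 ^+ i)
      & eigenrow (dp d) (q ^+ 2) (a / lam) (joukowski (nu^-1 * q ^+ 2 ^+ i))
         *m Bmat q d a b c lam *m (Amat q d a lam delta - (joukowski (mu * q ^+ 2))%:M)
        = kappa *: eigenrow (dp d) (q ^+ 2) (a / lam) (joukowski (nu^-1 * q ^+ 2 ^+ i))])
    /\ lowering (Bmat q d a b c lam) (theta_s q b lam)
         (eigenrow (dp d) (q ^+ 2) (a / lam) (joukowski (nu^-1 * q ^+ 2 ^+ i))) (dp d).-1 = 0.
  exists i; rewrite -evecE; split; last exact/Lw.
  exists mu, kappa; split=> //; last by rewrite -muQ -mulmxA.
  apply/eqP; rewrite -subr_eq0; move: eA'; rewrite eA => /eqP.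
  by rewrite eq_sym -subr_eq0 -scalerBl scaler_eq0 (negPf e0) orbF.
(* [Cmat] is a polynomial in the other two matrices, so stability under it is automatic. *)
have subM (X Y : 'M[F]_(dp d)) : (U *m X <= U)%MS -> (U *m Y <= U)%MS -> (U *m (X *m Y) <= U)%MS.
  by move=> UX UY; rewrite mulmxA; apply: submx_trans (submxMr Y UX) UY.
exists U; split=> //; first by rewrite mxrank_eq0.
rewrite /Cmat mulmxBr mul_mx_scalar -scalemxAr mulmxBr -!scalemxAr.
by rewrite addmx_sub ?eqmx_opp ?scalemx_sub // addmx_sub ?eqmx_opp ?scalemx_sub ?subM.
Qed.
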